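(* For every integer $n\ge 0$, $$p_{1/5}(7n+6)\equiv 0\pmod{49}.$$
   Context: For a rational number $k$, the rational numbers $p_k(n)$ ($n\ge 0$) are the coefficients of the power series $\sum_{n=0}^{\infty}p_{k}(n)q^n=(q;q)_{\infty}^{k}$, where $(q;q)_\infty=\prod_{m=1}^{\infty}(1-q^m)$ and the power is defined by $(q;q)_\infty^{k}=\prod_{m=1}^\infty(1-q^m)^{k}$, each factor being expanded by the generalized binomial theorem $(1-x)^k=\sum_{i\ge 0}\binom{k}{i}(-1)^i x^i$. A rational number $x$ whose reduced denominator is coprime to a positive integer $M$ satisfies $x\equiv 0\pmod M$ if $M$ divides the numerator of $x$ in reduced form. (When $k$ has reduced denominator $b$, every prime dividing the denominator of $p_k(n)$ divides $b$, so the congruence is meaningful.) *)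

(* Defs.v *)
From mathcomp Require Import all_boot all_order all_algebra.

Set Implicit Arguments.
Unset Strict Implicit.
Unset Printing Implicit Defensive.

Import GRing.Theory.
Local Open Scope ring_scope.

(* A formal power series is represented by its coefficient sequence. *)
Definition series := nat -> rat.

Definition series1 : series := fun n => (n == 0%N)%:R.

Definition smul (f g : series) : series :=
  fun n => \sum_(i < n.+1) f i * g (n - i)%N.

Definition gbinom (k : rat) (i : nat) : rat :=
  (\prod_(j < i) (k - j%:R)) / i`!%:R.

(* (1 - q^m)^k expanded in powers of q, for m > 0: the coefficient of q^(m i)
   is 'binom(k, i) (-1)^i. *)
Definition euler_factor (k : rat) (m : nat) : series :=
  fun n => if (m %| n)%N then gbinom k (n %/ m) * (-1) ^+ (n %/ m) else 0.

(* \prod_(1 <= m <= N) (1 - q^m)^k *)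
Fixpoint euler_partial (k : rat) (N : nat) : series :=
  if N is N'.+1 then smul (euler_partial k N') (euler_factor k N'.+1)
  else series1.

(* The coefficient of q^n in the infinite product. The infinite product is the
   coefficientwise limit of the partial products, and the coefficient of q^n
   is constant from the n-th partial product on (see pfracE). *)
Definition pfrac (k : rat) (n : nat) : rat := euler_partial k n n.

Lemma pfracE (k : rat) (n N : nat) :
  (n <= N)%N -> euler_partial k N n = pfrac k n.
Proof.
elim: N => [|N IH]; first by rewrite leqn0 => /eqP->.
rewrite leq_eqVlt => /orP[/eqP-> // | lt_nN] /=.
rewrite /smul big_ord_recr /= subnn big1 ?add0r => [|i _]; last first.
  rewrite /euler_factor gtnNdvd ?mulr0 ?subn_gt0 //.
  exact: leq_ltn_trans (leq_subr _ _) lt_nN.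
by rewrite /euler_factor dvdn0 div0n /gbinom big_ord0 expr0 fact0 invr1 !mulr1 IH.
Qed.

(* x = 0 mod M, for M > 0 and a rational x with denominator coprime to M. *)
Definition rat_eq0_mod (M : nat) (x : rat) : Prop :=
  coprime `|denq x|%N M /\ (M %| `|numq x|%N)%N.

(* Main.v *)
Require Import Defs.
From HB Require Import structures.
From mathcomp Require Import all_boot all_order all_algebra.
From mathcomp Require Import boolp.
From mathcomp Require Import zify ring.

(* Write E for the Euler product and f = E^(1/5). The coefficients of f are
   7-integral because f^5 = E. Since q d/dq (f^49) = 49 f^48 q f', the n-th
   coefficient of f^49 is divisible by 49 unless 7 divides n; as
   f f^49 = E^10, it suffices to treat the coefficients of E^10.

   With eta = q E(q^24), one has
     96 eta^10 = \sum_(x, y) chi4(x) chi4(y) (x^3 y - x y^3) q^(x^2 + y^2)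
   over the x prime to 3 and the y divisible by 3. An exponent divisible by 7
   forces 7 | x and 7 | y, hence 49 divides the coefficient.

   This identity follows from changes of lattice in theta series. The
   pentagonal series is eta (Shanks). The Jacobi series
   \sum_y chi4(y) y q^(3 y^2) is 2 eta^3, because a rotation of order 3 of the
   form x^2 + 3 y^2 shows that it satisfies the differential equation of
   eta^3. Rotating by (x, y) |-> (x + y, x - y), and by the multiplication by
   1 - sqrt (-2) for the form x^2 + 2 y^2, then expresses eta^12 as eta^2 times
   the double sum. *)

Set Implicit Arguments.
Unset Strict Implicit.
Unset Printing Implicit Defensive.

Import Order.TTheory GRing.Theory Num.Theory.
Local Open Scope ring_scope.

(** * The ring of formal power series *)

HB.instance Definition _ := gen_eqMixin series.
HB.instance Definition _ := gen_choiceMixin series.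

Definition sadd (f g : series) : series := fun n => f n + g n.
Definition sopp (f : series) : series := fun n => - f n.
Definition szero : series := fun=> 0.

Fact saddA : associative sadd.
Proof. by move=> f g h; apply/funext => n; apply: addrA. Qed.
Fact saddC : commutative sadd.
Proof. by move=> f g; apply/funext => n; apply: addrC. Qed.
Fact sadd0 : left_id szero sadd.
Proof. by move=> f; apply/funext => n; apply: add0r. Qed.
Fact saddN : left_inverse szero sopp sadd.
Proof. by move=> f; apply/funext => n; apply: addNr. Qed.

HB.instance Definition _ := GRing.isZmodule.Build series saddA saddC sadd0 saddN.

Definition strunc (n : nat) (f : series) : {poly rat} := \poly_(i < n.+1) f i.

Lemma coef_strunc n f i : (i <= n)%N -> (strunc n f)`_i = f i.
Proof. by move=> le_in; rewrite coef_poly ltnS le_in. Qed.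

(** Only indices up to [m] enter the coefficient, so the ring laws of [series] can be inherited from
    polynomials. *)
Lemma smul_strunc n m f g : (m <= n)%N ->
  smul f g m = (strunc n f * strunc n g)`_m.
Proof.
move=> le_mn; rewrite coefM; apply: eq_bigr => i _.
by rewrite !coef_strunc // ?(leq_trans (leq_subr _ _)) // -ltnS (leq_trans (ltn_ord i)).
Qed.

Fact smulC : commutative smul.
Proof. by move=> f g; apply/funext => n; rewrite !(smul_strunc _ _ (leqnn n)) mulrC. Qed.

Fact smulA : associative smul.
Proof.
move=> f g h; apply/funext => n; rewrite !(smul_strunc _ _ (leqnn n)).
(* The truncation of a product is not the product of the truncations, but the two agree through
   degree [n], which is all that the [n]-th coefficient sees. *)
have step (p : {poly rat}) a b :
    (p * strunc n (smul a b))`_n = (p * (strunc n a * strunc n b))`_n.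
  rewrite !coefM; apply: eq_bigr => i _; congr (_ * _).
  by rewrite coef_strunc ?leq_subr // (@smul_strunc n) ?leq_subr.
by rewrite step [in RHS]mulrC step mulrA mulrC mulrA.
Qed.

Fact smul1 : left_id series1 smul.
Proof.
move=> f; apply/funext => n; rewrite /smul big_ord_recl mul1r subn0 big1 ?addr0 //.
by move=> i _; rewrite mul0r.
Qed.

Fact smulDl : left_distributive smul sadd.
Proof.
move=> f g h; apply/funext => n; rewrite /smul /sadd -big_split.
by apply: eq_bigr => i _; rewrite mulrDl.
Qed.

Fact series1_neq0 : series1 != szero.
Proof. by apply/eqP => /(congr1 (fun f : series => f 0%N)) /eqP; rewrite oner_eq0. Qed.

HB.instance Definition _ := GRing.Zmodule_isComNzRing.Build series
  smulA smulC smul1 smulDl series1_neq0.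

Lemma scoefD (f g : series) n : (f + g) n = f n + g n. Proof. by []. Qed.
Lemma scoefN (f : series) n : (- f) n = - f n. Proof. by []. Qed.
Lemma scoefB (f g : series) n : (f - g) n = f n - g n. Proof. by []. Qed.
Lemma scoef0 n : (0 : series) n = 0. Proof. by []. Qed.
Lemma scoef1 n : (1 : series) n = (n == 0%N)%:R. Proof. by []. Qed.
Lemma scoefMn (f : series) k n : (f *+ k) n = f n *+ k.
Proof. by elim: k => // k IH; rewrite !mulrS scoefD IH. Qed.
Lemma scoefM (f g : series) n : (f * g) n = \sum_(i < n.+1) f i * g (n - i)%N.
Proof. by []. Qed.
Lemma scoef_sum I (r : seq I) P (F : I -> series) n :
  (\sum_(i <- r | P i) F i) n = \sum_(i <- r | P i) F i n.
Proof. by elim/big_rec2: _ => //= i y x _ <-. Qed.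
Lemma scoefM0 (f g : series) : (f * g) 0%N = f 0%N * g 0%N.
Proof. by rewrite scoefM big_ord1. Qed.

Lemma scoefX0 (f : series) k : (f ^+ k) 0%N = f 0%N ^+ k.
Proof. by elim: k => // k IH; rewrite !exprS scoefM0 IH. Qed.

Definition monom (m : nat) : series := fun n => (n == m)%:R.

Lemma scoef_monomM m (f : series) n :
  (monom m * f) n = if (m <= n)%N then f (n - m)%N else 0.
Proof.
rewrite scoefM; case: leqP => [le_mn|lt_nm].
  rewrite (bigD1 (Ordinal (le_mn : m < n.+1)%N)) //= /monom eqxx mul1r big1 ?addr0 //.
  by move=> i; rewrite -val_eqE /= => /negPf ->; rewrite mul0r.
by rewrite big1 // => i _; rewrite /monom ltn_eqF ?mul0r // (leq_trans _ lt_nm).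
Qed.

Lemma monomD m n : monom (m + n) = monom m * monom n.
Proof.
apply/funext => k; rewrite scoef_monomM /monom.
case: leqP => h; last by rewrite ltn_eqF //; lia.
by congr (nat_of_bool _)%:R; apply/eqP/eqP; lia.
Qed.

Lemma monom0 : monom 0 = 1. Proof. by []. Qed.

Lemma monomX m k : monom m ^+ k = monom (m * k).
Proof. by elim: k => [|k IH]; rewrite ?muln0 // exprS IH mulnS monomD. Qed.

(** * The operator q d/dq, orders of vanishing and linear differential equations *)

Definition qderiv (f : series) : series := fun n => n%:R * f n.

Lemma qderivM f g : qderiv (f * g) = qderiv f * g + f * qderiv g.
Proof.
apply/funext => n; rewrite scoefD !scoefM /qderiv scoefM mulr_sumr -big_split /=.
apply: eq_bigr => i _; have le_in : (i <= n)%N by rewrite -ltnS.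
by rewrite -[in n%:R](subnKC le_in) natrD; ring.
Qed.

Lemma qderivX f k : qderiv (f ^+ k.+1) = (f ^+ k * qderiv f) *+ k.+1.
Proof.
elim: k => [|k IH]; first by rewrite mul1r.
rewrite exprS qderivM IH -mulrnAr mulrA -exprS mulrnAr [X in X + _]mulrC.
by rewrite -mulrS.
Qed.

Definition sorder (m : nat) (f : series) := forall i, (i < m)%N -> f i = 0.

Lemma sorderM m k f g : sorder m f -> sorder k g -> sorder (m + k) (f * g).
Proof.
move=> fm gk n lt_n; rewrite scoefM big1 // => i _.
by case: (ltnP i m) => h; [rewrite fm ?mul0r | rewrite gk ?mulr0 //; have := ltn_ord i; lia].
Qed.

Lemma scoefM_low m k (f g : series) : sorder m f -> sorder k g ->
  (f * g) (m + k)%N = f m * g k.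
Proof.
move=> fm gk; rewrite scoefM.
have lt_m : (m < (m + k).+1)%N by lia.
rewrite (bigD1 (Ordinal lt_m)) //= addKn big1 ?addr0 // => i.
rewrite -val_eqE /= neq_ltn => /orP[h|h]; first by rewrite fm ?mul0r.
by rewrite gk ?mulr0 //; have := ltn_ord i; lia.
Qed.

(* Uniqueness for the linear ODE [P q h' = R h]: if [P] and [R] have order [m],
   every coefficient whose index is not a root of the indicial polynomial
   [n p_m - r_m] is determined by the previous ones. *)
Lemma qderiv_uniq m (P R h : series) : sorder m P -> sorder m R ->
  P * qderiv h = R * h ->
  (forall n, n%:R * P m - R m = 0 -> h n = 0) -> h = 0.
Proof.
move=> Pm Rm ode hroot; apply/funext => n; rewrite scoef0.
elim/ltn_ind: n => n IH; have [/hroot //|nz] := eqVneq (n%:R * P m - R m) 0.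
have hn : sorder n h by [].
have Dhn : sorder n (qderiv h) by move=> i lt_in; rewrite /qderiv hn ?mulr0.
have := congr1 (fun f : series => f (m + n)%N) ode.
rewrite !scoefM_low // /qderiv mulrA => /eqP; rewrite -subr_eq0 -mulrBl.
by rewrite [P m * _]mulrC mulf_eq0 (negPf nz) => /eqP.
Qed.

(** Degenerate case of [qderiv_uniq]: with zero coefficient in front of [qderiv h], the indicial
    polynomial is the nonzero constant [- P m]. *)
Lemma smul_eq0_low m (P h : series) : sorder m P -> P m != 0 -> P * h = 0 -> h = 0.
Proof.
move=> Pm nz Ph0; apply: (@qderiv_uniq m 0 P) => //.
  by rewrite mul0r Ph0.
by move=> n /eqP; rewrite scoef0 mulr0 sub0r oppr_eq0 (negPf nz).
Qed.

(** * Roots of the Euler product *)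

Lemma sorder_eqX m k (f g : series) : sorder m (f - g) -> sorder m (f ^+ k - g ^+ k).
Proof. by move=> fg; rewrite subrXX -[m]addn0; apply: sorderM. Qed.

Lemma gbinomS k i : gbinom k i.+1 * i.+1%:R = (k - i%:R) * gbinom k i.
Proof.
rewrite /gbinom big_ord_recr /= factS natrM.
have fact_nz : i`!%:R != 0 :> rat by rewrite pnatr_eq0 -lt0n fact_gt0.
by field; rewrite fact_nz nat1r pnatr_eq0.
Qed.

(** The logarithmic derivative of (1 - q^m)^(1/d), cleared of denominators; on coefficients it is
    the recurrence [gbinomS]. *)
Lemma euler_factor_ode d m : (0 < d)%N -> (0 < m)%N ->
  ((1 - monom m) * qderiv (euler_factor d%:R^-1 m)) *+ d =
  - (monom m *+ m) * euler_factor d%:R^-1 m.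
Proof.
move=> d_gt0 m_gt0; set b := euler_factor _ _; apply/funext => n.
rewrite mulrBl mul1r scoefMn scoefB mulNr mulrnAl scoefN scoefMn !scoef_monomM.
have [dvd_mn|ndvd_mn] := boolP (m %| n)%N; last first.
  have b0 k : ~~ (m %| k)%N -> b k = 0 by rewrite /b /euler_factor => /negPf->.
  rewrite /qderiv b0 // mulr0; case: leqP => [le_mn|_]; last by rewrite subr0 !mul0rn oppr0.
  by rewrite b0 ?dvdn_subl // mulr0 subr0 !mul0rn oppr0.
case/dvdnP: dvd_mn => -[|i] ->; first by rewrite leqNgt m_gt0 /qderiv mul0r !subr0 !mul0rn oppr0.
rewrite mulSn leq_addr addKn.
have bE k : b (k * m)%N = gbinom d%:R^-1 k * (-1) ^+ k.
  by rewrite /b /euler_factor dvdn_mull // mulnK.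
rewrite /qderiv -mulSn !bE -(mulr_natl (_ - _) d) -(mulr_natl (gbinom _ _ * _) m).
rewrite (natrM _ i.+1) (natrM _ i).
have -> : gbinom d%:R^-1 i.+1 = (d%:R^-1 - i%:R) * gbinom d%:R^-1 i / i.+1%:R.
  by rewrite -gbinomS mulfK // pnatr_eq0.
have d_nz : d%:R != 0 :> rat by rewrite pnatr_eq0 -lt0n.
by rewrite exprS; field; rewrite d_nz nat1r pnatr_eq0.
Qed.

(** Both sides solve (1 - q^m) q h' = - m q^m h. The only indicial root is 0, and the constant terms
    agree. *)
Lemma euler_factor_root d m : (0 < d)%N -> (0 < m)%N ->
  (euler_factor d%:R^-1 m) ^+ d = 1 - monom m :> series.
Proof.
case: d => // d _ m_gt0; set b := euler_factor _ _.
have ode := euler_factor_ode (ltn0Sn d) m_gt0; rewrite -/b in ode.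
have b0 : b 0%N = 1.
  by rewrite /b /euler_factor dvdn0 div0n /gbinom big_ord0 expr0 fact0 invr1 !mulr1.
have x0 : monom m 0%N = 0 by rewrite /monom ltn_eqF.
apply/eqP; rewrite -subr_eq0; apply/eqP.
apply: (@qderiv_uniq 0 (1 - monom m) (- (monom m *+ m))) => //; last first.
  move=> n; rewrite scoefB scoef1 scoefN scoefMn x0 mul0rn oppr0 !subr0 mulr1.
  move/eqP; rewrite pnatr_eq0 => /eqP ->.
  by rewrite scoefB scoefX0 b0 expr1n scoefB scoef1 x0 subr0 subrr.
have Dx : qderiv (1 - monom m) = - (monom m *+ m).
  apply/funext => n; rewrite /qderiv scoefB scoef1 scoefN scoefMn /monom.
  case: (eqVneq n 0%N) => [->|_]; first by rewrite mul0r ltn_eqF // mul0rn oppr0.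
  case: eqVneq => [->|_]; first by rewrite sub0r mulrN mulr1.
  by rewrite subrr mulr0 mul0rn oppr0.
have qderivB f g : qderiv (f - g) = qderiv f - qderiv g.
  by apply/funext => n; apply: mulrBr.
rewrite qderivB qderivX mulrBr [RHS]mulrBr Dx [X in _ - X]mulrC; congr (_ - _).
by rewrite -mulrnAr mulrCA mulrnAr ode mulrCA -exprSr.
Qed.

Lemma euler_partial_rootX d N : (0 < d)%N ->
  (euler_partial d%:R^-1 N : series) ^+ d = \prod_(i < N) (1 - monom i.+1).
Proof.
move=> d_gt0; elim: N => [|N IH]; first by rewrite big_ord0 expr1n.
by rewrite big_ord_recr /= -IH -(@euler_factor_root d) // -exprMn.
Qed.

Definition euler : series := fun n => (\prod_(i < n) (1 - monom i.+1) : series) n.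

Lemma eulerE n N : (n <= N)%N -> (\prod_(i < N) (1 - monom i.+1) : series) n = euler n.
Proof.
have E M : (\prod_(i < M) (1 - monom i.+1) : series) = euler_partial 1%:R^-1 M.
  by rewrite -(@euler_partial_rootX 1).
by move=> le_nN; rewrite /euler !E pfracE.
Qed.

(** The series agrees with its [n]-th partial product through q^n, hence so do the [d]-th powers. *)
Lemma pfrac_rootX d : (0 < d)%N -> (pfrac d%:R^-1 : series) ^+ d = euler.
Proof.
move=> d_gt0; apply/funext => n; rewrite /euler -(@euler_partial_rootX d) //.
apply/eqP; rewrite -subr_eq0 -scoefB (@sorder_eqX n.+1) // => i lt_in.
by rewrite scoefB pfracE ?subrr.
Qed.

(** * Divisibility in the localization of the integers at a prime *)

(** Membership in M Z_(p). The denominator [b] need not be reduced, which makes closure under sums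
    and products immediate. *)
Definition pdvd (p M : nat) (x : rat) : Prop :=
  exists a : int, exists2 b : nat, coprime p b & x * b%:R = M%:R * a%:~R.

Lemma pdvd_int p M (a : int) : pdvd p M (M%:R * a%:~R).
Proof. by exists a, 1%N; rewrite ?coprimen1 // mulr1. Qed.

Lemma pdvd0 p M : pdvd p M 0.
Proof. by have := pdvd_int p M 0; rewrite mulr0. Qed.

Lemma pdvdD p M x y : pdvd p M x -> pdvd p M y -> pdvd p M (x + y).
Proof.
move=> [a [b cpb xE]] [a' [b' cpb' yE]]; exists (a * b' + a' * b), (b * b')%N.
  by rewrite coprimeMr cpb.
rewrite natrM !rmorphD !rmorphM /= -!pmulrn.
have -> : (x + y) * (b%:R * b'%:R) = x * b%:R * b'%:R + y * b'%:R * b%:R by ring.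
by rewrite xE yE; ring.
Qed.

Lemma pdvdN p M x : pdvd p M x -> pdvd p M (- x).
Proof. by move=> [a [b cpb xE]]; exists (- a), b => //; rewrite mulNr xE rmorphN mulrN. Qed.

Lemma pdvdM p M N x y : pdvd p M x -> pdvd p N y -> pdvd p (M * N) (x * y).
Proof.
move=> [a [b cpb xE]] [a' [b' cpb' yE]]; exists (a * a'), (b * b')%N.
  by rewrite coprimeMr cpb.
rewrite !natrM rmorphM /=.
have -> : x * y * (b%:R * b'%:R) = (x * b%:R) * (y * b'%:R) by ring.
by rewrite xE yE; ring.
Qed.

Lemma pdvdMl p M x y : pdvd p M x -> pdvd p 1 y -> pdvd p M (x * y).
Proof. by move=> /pdvdM xM /xM; rewrite muln1. Qed.

Lemma pdvdMr p M x y : pdvd p 1 x -> pdvd p M y -> pdvd p M (x * y).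
Proof. by move=> x1 yM; rewrite mulrC; apply: pdvdMl. Qed.

Lemma pdvd_sum p M I (r : seq I) (P : pred I) (F : I -> rat) :
  (forall i, P i -> pdvd p M (F i)) -> pdvd p M (\sum_(i <- r | P i) F i).
Proof. by move=> FM; elim/big_ind: _ => //; [apply: pdvd0 | apply: pdvdD]. Qed.

Lemma pdvd_cancel p M n x : coprime p n -> pdvd p M (n%:R * x) -> pdvd p M x.
Proof.
move=> cpn [a [b cpb xE]]; exists a, (n * b)%N; first by rewrite coprimeMr cpn.
by rewrite natrM -xE; ring.
Qed.

Lemma pdvd_rat_eq0_mod p k x : prime p -> pdvd p (p ^ k.+1) x -> rat_eq0_mod (p ^ k.+1) x.
Proof.
move=> p_pr [a [b cpb xE]].
have xd : x * (denq x)%:~R = (numq x)%:~R.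
  by rewrite -{1}[x]divq_num_den divfK // intr_eq0 denq_neq0.
have numE : numq x * b = (p ^ k.+1)%N%:Z * a * denq x.
  apply: (@intr_inj rat); rewrite !rmorphM /= -!pmulrn -xE -xd; ring.
have {}numE : (`|numq x| * b = p ^ k.+1 * `|a| * `|denq x|)%N.
  by have := congr1 absz numE; rewrite !abszM !absz_nat.
have cnd := coprime_num_den x.
have dvd_db : (`|denq x| %| b)%N.
  by rewrite -(@Gauss_dvdr _ `|numq x| b) 1?coprime_sym // numE dvdn_mull.
split; first by rewrite coprime_sym coprimeXl // (coprime_dvdr dvd_db).
by rewrite -(@Gauss_dvdl _ _ b) ?numE -?mulnA ?dvdn_mulr // coprimeXl.
Qed.

Definition sint (p : nat) (f : series) : Prop := forall n, pdvd p 1 (f n).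

Lemma sintM p (f g : series) : sint p f -> sint p g -> sint p (f * g).
Proof. by move=> fp gp n; rewrite scoefM; apply: pdvd_sum => i _; apply: pdvdMl. Qed.

Lemma sintX p (f : series) k : sint p f -> sint p (f ^+ k).
Proof.
move=> fp; elim: k => [n|k IH]; last by rewrite exprS; apply: sintM.
by rewrite expr0 scoef1; have := pdvd_int p 1 (n == 0%N); rewrite mul1r -pmulrn.
Qed.

(** The coefficient of index [n.+1] in [f ^+ d] is [d * f n.+1] plus an integral polynomial in the
    earlier coefficients, and [d] is invertible at [p]. *)
Lemma sint_root p d (f : series) : coprime p d -> (0 < d)%N -> f 0%N = 1 ->
  sint p (f ^+ d) -> sint p f.
Proof.
move=> cpd d_gt0 f0 fdp n; elim/ltn_ind: n => -[_|n IH].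
  by rewrite f0; have := pdvd_int p 1 1; rewrite mul1r.
pose g : series := fun i => if (i <= n)%N then f i else 0.
have gp : sint p g by move=> i; rewrite /g; case: leqP => [/IH //|_]; apply: pdvd0.
have hn : sorder n.+1 (f - g) by move=> i lt_in; rewrite scoefB /g -ltnS lt_in subrr.
apply: (pdvd_cancel cpd).
(* [f ^+ d - g ^+ d] is [f - g], of order [n.+1], times a sum of [d] products with constant term
   1. *)
suff -> : d%:R * f n.+1 = (f ^+ d) n.+1 - (g ^+ d) n.+1.
  by apply: pdvdD (fdp _) (pdvdN (sintX _ gp _)).
rewrite -scoefB subrXX -[X in _ = _ X]addn0 scoefM_low // scoefB {1}/g ltnn subr0.
rewrite mulrC scoef_sum (eq_bigr (fun=> 1)) => [|i _].
  by rewrite sumr_const card_ord.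
by rewrite scoefM0 !scoefX0 /g /= f0 !expr1n mul1r.
Qed.

(* [q d/dq (f^M) = M f^(M-1) q f'] *)
Lemma pdvd_scoefX p M (f : series) n : prime p -> sint p f -> ~~ (p %| n)%N ->
  pdvd p M ((f ^+ M) n).
Proof.
move=> p_pr fp ndvd; case: M => [|M].
  by rewrite expr0 scoef1; case: eqP ndvd => [->|_ _]; rewrite ?dvdn0 //; apply: pdvd0.
apply: (@pdvd_cancel p _ n); first by rewrite prime_coprime.
have -> : n%:R * (f ^+ M.+1) n = M.+1%:R * (f ^+ M * qderiv f) n.
  by rewrite -[LHS]/(qderiv _ _) qderivX scoefMn mulr_natl.
apply: pdvdMl; first by have := pdvd_int p M.+1 1; rewrite mulr1.
apply: (sintM (sintX _ fp)) => k.
by apply: pdvdMr (fp k); have := pdvd_int p 1 k; rewrite mul1r -pmulrn.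
Qed.

Lemma pdvd_scoef_progression p M (f : series) r : prime p -> f 0%N = 1 -> sint p f ->
  (forall n, n = r %[mod p] -> pdvd p M ((f ^+ M.+1) n)) ->
  forall n, n = r %[mod p] -> pdvd p M (f n).
Proof.
move=> p_pr f0 fp fM; elim/ltn_ind => n IH n_r.
have := fM n n_r; rewrite exprS scoefM big_ord_recr /= subnn scoefX0 f0 expr1n mulr1.
set s := \sum_(_ < _) _ => sM; have -> : f n = s + f n - s by ring.
apply: pdvdD sM (pdvdN _); apply: pdvd_sum => i _.
(* In the convolution of [f] with [f ^+ M], either [n - i] is prime to [p] and the factor from
   [f ^+ M] is divisible by [M], or [i] lies in the same progression and induction applies. *)
have [dvd_p|ndvd_p] := boolP (p %| n - i)%N; last first.
  exact: pdvdMr (fp _) (pdvd_scoefX _ p_pr fp ndvd_p).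
apply: pdvdMl (sintX _ fp _); apply: IH => //.
by apply/eqP; rewrite -n_r eq_sym eqn_mod_dvd // ltnW.
Qed.

(** * Theta series *)

(** Opposite integers are listed in pairs, so that enlarging the box by one adds [F x + F (- x)] to
    a sum. *)
Fixpoint box (n : nat) : seq int :=
  if n is m.+1 then [:: n%:Z, - n%:Z & box m] else [:: 0].

Lemma mem_box n x : (x \in box n) = (`|x| <= n)%N.
Proof.
elim: n => [|n IH] /=; first by rewrite inE leqn0 absz_eq0.
rewrite !inE IH; apply/or3P/idP => [[/eqP|/eqP|]|le_x]; [lia..|].
have [e|[e|e]] : x = n.+1%:Z \/ x = - n.+1%:Z \/ (`|x| <= n)%N by lia.
- by constructor 1; apply/eqP.
- by constructor 2; apply/eqP.
- by constructor 3.
Qed.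

Lemma box_uniq n : uniq (box n).
Proof.
elim: n => // n IH; rewrite [box _]/= !cons_uniq IH inE !mem_box andbT.
by apply/andP; split; lia.
Qed.

Lemma big_box_le (F : int -> rat) (P : pred int) m n : (m <= n)%N ->
  (forall x, P x -> (`|x| <= m)%N) ->
  \sum_(x <- box n | P x) F x = \sum_(x <- box m | P x) F x.
Proof.
elim: n => [|n IH] le_mn Pm; first by case: m le_mn {Pm}.
move: le_mn; rewrite leq_eqVlt => /orP[/eqP -> //|lt_mn].
rewrite [box n.+1]/= !big_cons IH //.
by case: ifP => [/Pm|_]; [lia|case: ifP => [/Pm|//]; lia].
Qed.

Definition box2 (n : nat) : seq (int * int) := [seq (x, y) | x <- box n, y <- box n].

Lemma mem_box2 n p : (p \in box2 n) = (`|p.1| <= n)%N && (`|p.2| <= n)%N.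
Proof.
case: p => x y; rewrite -!mem_box; apply/allpairsP/andP => /=.
  by case=> -[x' y'] /= [? ? [-> ->]].
by move=> [xn yn]; exists (x, y).
Qed.

Lemma box2_uniq n : uniq (box2 n).
Proof. by apply: allpairs_uniq; rewrite ?box_uniq // => -[? ?] [? ?]. Qed.

(** For positive [a], every solution of [a x^2 = n] has absolute value at most [n], so the finite
    box captures the whole theta series. *)
Definition theta1 (a : nat) (w : int -> int) : series := fun n =>
  \sum_(x <- box n | a%:Z * x ^+ 2 == n) (w x)%:~R.

Definition theta2 (a b : nat) (w : int -> int -> int) : series := fun n =>
  \sum_(p <- box2 n | a%:Z * p.1 ^+ 2 + b%:Z * p.2 ^+ 2 == n) (w p.1 p.2)%:~R.

Lemma absz_le_quad (a : nat) (x : int) (n : nat) : (0 < a)%N ->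
  a%:Z * x ^+ 2 <= n -> (`|x| <= n)%N.
Proof. by rewrite expr2; nia. Qed.

Lemma theta1_box a w m n : (0 < a)%N -> (n <= m)%N ->
  theta1 a w n = \sum_(x <- box m | a%:Z * x ^+ 2 == n) (w x)%:~R.
Proof.
move=> a_gt0 le_nm; symmetry; apply: big_box_le => // x /eqP xn.
by apply: (absz_le_quad a_gt0); rewrite xn.
Qed.

Lemma eq_theta2 a b w w' : w =2 w' -> theta2 a b w = theta2 a b w'.
Proof. by move=> ww'; apply/funext => n; apply: eq_bigr => p _; rewrite ww'. Qed.

Lemma theta2D a b w w' :
  theta2 a b (fun x y => w x y + w' x y) = theta2 a b w + theta2 a b w'.
Proof.
apply/funext => n; rewrite scoefD -big_split.
by apply: eq_bigr => p _; rewrite rmorphD.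
Qed.

Lemma theta2N a b w : theta2 a b (fun x y => - w x y) = - theta2 a b w.
Proof.
by apply/funext => n; rewrite scoefN -sumrN; apply: eq_bigr => p _; rewrite rmorphN.
Qed.

Lemma theta2B a b w w' :
  theta2 a b (fun x y => w x y - w' x y) = theta2 a b w - theta2 a b w'.
Proof. by rewrite -theta2N -theta2D. Qed.

Lemma theta2Z a b k w : theta2 a b (fun x y => k%:Z * w x y) = theta2 a b w *+ k.
Proof.
apply/funext => n; rewrite scoefMn -sumrMnl; apply: eq_bigr => p _.
by rewrite rmorphM /= -pmulrn mulr_natl.
Qed.

Lemma theta1M a b w w' : (0 < a)%N -> (0 < b)%N ->
  theta1 a w * theta1 b w' = theta2 a b (fun x y => w x * w' y).
Proof.
move=> a_gt0 b_gt0; apply/funext => n.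
transitivity (\sum_(i < n.+1) \sum_(p <- box2 n)
    if (a%:Z * p.1 ^+ 2 == i) && (b%:Z * p.2 ^+ 2 == (n - i)%N)
    then (w p.1)%:~R * (w' p.2)%:~R else 0 : rat).
  rewrite scoefM; apply: eq_bigr => i _.
  rewrite (@theta1_box a w n) 1?(@theta1_box b w' n) ?leq_subr //; last by case: i.
  rewrite big_distrlr big_allpairs [LHS]big_mkcond /=; apply: eq_bigr => x _.
  case: eqP => _ /=; last by rewrite big1.
  by rewrite [LHS]big_mkcond.
rewrite exchange_big /= /theta2 [RHS]big_mkcond /=; apply: eq_bigr => -[x y] _ /=.
(* A pair [(x, y)] can contribute only at the index [i = a x^2], which occurs in the convolution
   exactly when it is at most [n]. *)
have [le_xn|lt_nx] := ltnP `|(a%:Z * x ^+ 2)%R| n.+1.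
  rewrite (bigD1 (Ordinal le_xn)) //= big1 ?addr0 => [|i].
    by rewrite rmorphM /=; do 2!case: ifP => //; rewrite expr2; nia.
  by rewrite -val_eqE /=; case: ifP => // /andP[/eqP -> _]; rewrite absz_nat eqxx.
rewrite big1 => [|i _]; last first.
  by case: ifP => // /andP[/eqP xi _]; have := ltn_ord i; move: lt_nx; rewrite xi; lia.
by case: ifP => // /eqP; rewrite !expr2 in lt_nx *; nia.
Qed.

Lemma qderiv_theta1 a w :
  qderiv (theta1 a w) = theta1 a (fun x => a%:Z * x ^+ 2 * w x).
Proof.
apply/funext => n; rewrite /qderiv mulr_sumr; apply: eq_bigr => x /eqP xn.
by rewrite rmorphM xn.
Qed.

(** The maps need be mutually inverse only on the supports of the weights. This permits passing
    between a lattice and a sublattice, the congruence conditions being carried by the weights. *)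
Lemma theta2_reindex a b c d (w w' : int -> int -> int) (h h' : int * int -> int * int) :
  (0 < a)%N -> (0 < b)%N -> (0 < c)%N -> (0 < d)%N ->
  (forall p, w p.1 p.2 != 0 ->
    [/\ c%:Z * (h p).1 ^+ 2 + d%:Z * (h p).2 ^+ 2 = a%:Z * p.1 ^+ 2 + b%:Z * p.2 ^+ 2,
        w' (h p).1 (h p).2 = w p.1 p.2 & h' (h p) = p]) ->
  (forall p, w' p.1 p.2 != 0 ->
    [/\ a%:Z * (h' p).1 ^+ 2 + b%:Z * (h' p).2 ^+ 2 = c%:Z * p.1 ^+ 2 + d%:Z * p.2 ^+ 2,
        w (h' p).1 (h' p).2 = w' p.1 p.2 & h (h' p) = p]) ->
  theta2 a b w = theta2 c d w'.
Proof.
move=> a0 b0 c0 d0 hw hw'; apply/funext => n.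
pose supp e f (v : int -> int -> int) := [seq p : int * int <- box2 n |
  (e%:Z * p.1 ^+ 2 + f%:Z * p.2 ^+ 2 == n) && (v p.1 p.2 != 0)].
have theta_supp e f v : theta2 e f v n = \sum_(p <- supp e f v) (v p.1 p.2)%:~R.
  rewrite big_filter big_mkcondr; apply: eq_bigr => p _.
  by case: eqP => //= ->.
have mem_supp e f v p : (0 < e)%N -> (0 < f)%N -> (p \in supp e f v) =
    (e%:Z * p.1 ^+ 2 + f%:Z * p.2 ^+ 2 == n) && (v p.1 p.2 != 0).
  move=> e0 f0; rewrite mem_filter mem_box2; case: eqP => //= pn.
  rewrite (absz_le_quad e0) ?(absz_le_quad f0) ?andbT // -pn.
    by rewrite lerDr mulr_ge0 // sqr_ge0.
  by rewrite lerDl mulr_ge0 // sqr_ge0.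
rewrite !theta_supp.
rewrite [RHS](perm_big [seq h p | p <- supp a b w]) /=.
  rewrite big_map; apply: eq_big_seq => p; rewrite mem_supp // => /andP[_ wp].
  by have [_ -> _] := hw _ wp.
apply: uniq_perm; first by rewrite filter_uniq ?box2_uniq.
  rewrite map_inj_in_uniq ?filter_uniq ?box2_uniq // => p q.
  rewrite !mem_supp // => /andP[_ /hw[_ _ pK]] /andP[_ /hw[_ _ qK]] hpq.
  by rewrite -pK -qK hpq.
move=> p; rewrite mem_supp //; apply/andP/mapP => [[/eqP pn wp]|[q]].
  have [e1 e2 e3] := hw' _ wp; exists (h' p) => //.
  by rewrite mem_supp // e1 e2 pn eqxx.
rewrite mem_supp // => /andP[/eqP qn wq] ->.
by have [-> -> _] := hw _ wq; rewrite qn.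
Qed.

Lemma series_mulrn_eq0 (f : series) k : (0 < k)%N -> f *+ k = 0 -> f = 0.
Proof.
move=> k0 fk; apply/funext => n; have := congr1 (fun f : series => f n) fk.
by rewrite scoefMn scoef0 => /eqP; rewrite mulrn_eq0 eqn0Ngt k0 => /eqP.
Qed.

Lemma theta2_oppr a b w : (0 < a)%N -> (0 < b)%N ->
  theta2 a b w = theta2 a b (fun x y => w x (- y)).
Proof.
move=> a0 b0; pose h (p : int * int) := (p.1, - p.2).
by apply: (@theta2_reindex _ _ _ _ _ _ h h) => // -[x y] _;
  split; rewrite /h /= ?sqrrN ?opprK.
Qed.

Lemma theta2_oddr0 a b w : (0 < a)%N -> (0 < b)%N ->
  (forall x y, w x (- y) = - w x y) -> theta2 a b w = 0.
Proof.
move=> a0 b0 odd_w; apply: (@series_mulrn_eq0 _ 2) => //.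
rewrite mulr2n {1}theta2_oppr // -theta2D.
apply/funext => n; apply: big1 => p _.
by rewrite odd_w addNr.
Qed.

Lemma theta2_rot2 c w : (0 < c)%N ->
  (forall x y, w x y != 0 -> (2 %| x + y)%Z) ->
  theta2 c c w = theta2 (2 * c) (2 * c) (fun x y => w (x + y) (x - y)).
Proof.
move=> c0 w_even; have c20 : (0 < 2 * c)%N by rewrite muln_gt0.
pose h (p : int * int) := (((p.1 + p.2) %/ 2)%Z, ((p.1 - p.2) %/ 2)%Z).
pose h' (p : int * int) := (p.1 + p.2, p.1 - p.2).
apply: (@theta2_reindex _ _ _ _ _ _ h h') => // -[x y] /=.
  (* Parametrizing the sublattice by [x] and [k] removes the integer divisions, leaving polynomial
     identities. *)
  move=> /w_even xy; pose k := ((x + y) %/ 2)%Z.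
  have -> : y = k + (k - x) by rewrite /k; lia.
  rewrite /h /h' /=.
  have -> : ((x + (k + (k - x))) %/ 2)%Z = k by lia.
  have -> : ((x - (k + (k - x))) %/ 2)%Z = x - k by lia.
  rewrite PoszM; split; first ring.
    by congr w; ring.
  by congr pair; ring.
move=> _; rewrite PoszM /h /h' /=; split; [ring | by [] | congr pair; lia].
Qed.

(* Multiplication by [1 - sqrt (-2)] on [x + y sqrt (-2)], whose norm is [x^2 + 2 y^2] *)
Lemma theta2_rot3 w :
  theta2 3 6 w = theta2 1 2 (fun u v =>
    if (3 %| u + v)%Z then w ((u - 2 * v) %/ 3)%Z ((u + v) %/ 3)%Z else 0).
Proof.
pose h (p : int * int) := (p.1 + 2 * p.2, p.2 - p.1).
pose h' (p : int * int) := (((p.1 - 2 * p.2) %/ 3)%Z, ((p.1 + p.2) %/ 3)%Z).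
apply: (@theta2_reindex _ _ _ _ _ _ h h') => // -[x y] /=; rewrite /h /h' /=.
  move=> _; have -> : ((x + 2 * y - 2 * (y - x)) %/ 3)%Z = x by lia.
  have -> : ((x + 2 * y + (y - x)) %/ 3)%Z = y by lia.
  by split; [ring | rewrite ifT //; lia | ].
case: ifP => // xy _; pose k := ((x + y) %/ 3)%Z.
have -> : y = k *+ 3 - x by rewrite /k; lia.
have -> : ((x - 2 * (k *+ 3 - x)) %/ 3)%Z = x - k *+ 2 by lia.
have -> : ((x + (k *+ 3 - x)) %/ 3)%Z = k by lia.
by split; [ring | | congr pair; ring].
Qed.

(** * Characters *)

Definition chi4 (x : int) : int :=
  if (x %% 4)%Z == 1 then 1 else if (x %% 4)%Z == 3 then -1 else 0.
Definition chi3 (x : int) : int :=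
  if (x %% 3)%Z == 1 then 1 else if (x %% 3)%Z == 2 then -1 else 0.
Definition chi12 (x : int) : int := chi3 x * chi4 x.
Definition dv (d x : int) : int := if (d %| x)%Z then 1 else 0.
Definition ndv (d x : int) : int := 1 - dv d x.

Lemma eq_chi4 x y : (x %% 4)%Z = (y %% 4)%Z -> chi4 x = chi4 y.
Proof. by rewrite /chi4 => ->. Qed.

Lemma chi4_opp x y : (4 %| x + y)%Z -> chi4 y = - chi4 x.
Proof.
rewrite /chi4 => xy; have : (x %% 4)%Z \in [:: 0; 1; 2; 3] by rewrite !inE; lia.
rewrite !inE => /or4P[] /eqP ex; rewrite ex.
- by rewrite (_ : (y %% 4)%Z = 0) //; lia.
- by rewrite (_ : (y %% 4)%Z = 3) //; lia.
- by rewrite (_ : (y %% 4)%Z = 2) //; lia.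
- by rewrite (_ : (y %% 4)%Z = 1) //; lia.
Qed.

Lemma chi4_even x : (2 %| x)%Z -> chi4 x = 0.
Proof. by rewrite /chi4 => x2; rewrite !ifF //; lia. Qed.

Lemma chi4_neq0 x : chi4 x != 0 -> (x %% 2)%Z = 1.
Proof. by have [/chi4_even -> //|] := boolP (2 %| x)%Z; lia. Qed.

Lemma chi4_sqr x : (x %% 2)%Z = 1 -> chi4 x * chi4 x = 1.
Proof.
rewrite /chi4 => x2; have [->|->] : (x %% 4)%Z = 1 \/ (x %% 4)%Z = 3 by lia.
- by [].
- by [].
Qed.

Lemma eq_chi3 x y : (x %% 3)%Z = (y %% 3)%Z -> chi3 x = chi3 y.
Proof. by rewrite /chi3 => ->. Qed.

(** The product vanishes unless [s] and [d] have opposite parities. Then [s + d] and [s - d] differ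
    by [2 d] and sum to [2 s]: they are congruent mod 4 if [d] is even, opposite mod 4 if [s] is
    even. *)
Lemma chi4_addM_sub s d :
  chi4 (s + d) * chi4 (s - d) = ndv 2 s * dv 2 d - dv 2 s * ndv 2 d.
Proof.
rewrite /ndv /dv; have [s2|s2] := boolP (2 %| s)%Z; have [d2|d2] := boolP (2 %| d)%Z.
- by rewrite chi4_even ?mul0r //; lia.
- by rewrite (@chi4_opp (s + d) (s - d)) ?mulrN ?chi4_sqr //; lia.
- by rewrite (@eq_chi4 (s - d) (s + d)) ?chi4_sqr //; lia.
- by rewrite chi4_even ?mul0r //; lia.
Qed.

Lemma chi3_addM_sub s d :
  chi3 (s + d) * chi3 (s - d) = ndv 3 s * dv 3 d - dv 3 s * ndv 3 d.
Proof.
have res x : (x %% 3)%Z = 0 \/ (x %% 3)%Z = 1 \/ (x %% 3)%Z = 2 by lia.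
have dvE x : dv 3 x = if (x %% 3)%Z == 0 then 1 else 0.
  by rewrite /dv; congr (if _ then _ else _); lia.
rewrite /ndv !dvE /chi3.
have -> : ((s + d) %% 3)%Z = (((s %% 3)%Z + (d %% 3)%Z) %% 3)%Z by lia.
have -> : ((s - d) %% 3)%Z = (((s %% 3)%Z + (3 - (d %% 3)%Z)) %% 3)%Z by lia.
by have [->|[->|->]] := res s; have [->|[->|->]] := res d.
Qed.

(** * Identities between theta series *)

(* [eta2 = 2 eta(24 z)] and [jacobi2 = 2 eta(24 z)^3], the pentagonal and Jacobi series *)
Definition eta2 : series := theta1 1 chi12.
Definition jacobi2 : series := theta1 3 (fun x => x * chi4 x).
Definition jacobi2_cube : series := theta1 3 (fun x => x ^+ 3 * chi4 x).
Definition theta_even k : series := theta1 6 (fun x => dv 2 x * x ^+ k).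
Definition theta_odd k : series := theta1 6 (fun x => ndv 2 x * x ^+ k).
Definition theta_ndv3 k : series := theta1 1 (fun x => ndv 3 x * chi4 x * x ^+ k).
Definition theta_dv3 k : series := theta1 1 (fun x => dv 3 x * chi4 x * x ^+ k).
Definition th2 (e t : int -> int) : series := theta1 2 (fun x => e x * t x).

(** After the rotation x = s + d, y = s - d, the character products expand into four terms, which
    pair up under the exchange of [s] and [d]. *)
Lemma eta2_sqr : eta2 * eta2 =
  (th2 (ndv 2) (ndv 3) * th2 (dv 2) (dv 3) - th2 (ndv 2) (dv 3) * th2 (dv 2) (ndv 3)) *+ 2.
Proof.
rewrite /eta2 theta1M // theta2_rot2 // => [|x y]; last first.
  rewrite /chi12; have [x2|x2] := boolP (2 %| x)%Z.
    by rewrite (chi4_even x2) ?mulr0 mul0r eqxx.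
  have [y2|y2 _] := boolP (2 %| y)%Z; first by rewrite (chi4_even y2) !mulr0 eqxx.
  by lia.
transitivity (th2 (ndv 2) (ndv 3) * th2 (dv 2) (dv 3) - th2 (ndv 2) (dv 3) * th2 (dv 2) (ndv 3)
  + (th2 (dv 2) (dv 3) * th2 (ndv 2) (ndv 3) - th2 (dv 2) (ndv 3) * th2 (ndv 2) (dv 3))).
  rewrite /th2 !theta1M // -!theta2B -theta2D; apply: eq_theta2 => x y.
  by rewrite /chi12 mulrACA chi4_addM_sub chi3_addM_sub; ring.
by rewrite [in X in _ + X]mulrC [X in _ + (_ - X)]mulrC mulr2n.
Qed.

(** The same rotation turns the weight [x y] into [s^2 - d^2], whence the second moments. *)
Lemma jacobi2_sqr :
  jacobi2 * jacobi2 = (theta_odd 2 * theta_even 0 - theta_odd 0 * theta_even 2) *+ 2.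
Proof.
rewrite /jacobi2 theta1M // theta2_rot2 // => [|x y]; last first.
  have [x2|x2] := boolP (2 %| x)%Z.
    by rewrite (chi4_even x2) ?mulr0 mul0r eqxx.
  have [y2|y2 _] := boolP (2 %| y)%Z; first by rewrite (chi4_even y2) !mulr0 eqxx.
  by lia.
transitivity (theta_odd 2 * theta_even 0 - theta_odd 0 * theta_even 2
    + (theta_even 0 * theta_odd 2 - theta_even 2 * theta_odd 0)).
  rewrite /theta_odd /theta_even !theta1M // -!theta2B -theta2D; apply: eq_theta2 => x y.
  by rewrite mulrACA chi4_addM_sub; ring.
by rewrite [in X in _ + X]mulrC [X in _ + (_ - X)]mulrC mulr2n.
Qed.

(** * Rotation of the form x^2 + 2 y^2 *)

Definition rotE k : series := theta2 1 2 (fun u v => dv 3 (u + v) * (ndv 2 v * (chi4 u * u ^+ k))).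
Definition rotO k : series := theta2 1 2 (fun u v => dv 3 (u + v) * (dv 2 v * (chi4 u * u ^+ k))).

(** The rotation is u = y + 2 s, v = s - y. Since [y] is odd on the support, even [s] means odd [v],
    and then [chi4 u = chi4 y]. *)
Lemma theta2_rotE k :
  theta2 3 6 (fun y s => dv 2 s * (chi4 y * (y + 2 * s) ^+ k)) = rotE k.
Proof.
rewrite theta2_rot3; apply: eq_theta2 => u v; rewrite /ndv /dv.
case: ifP => uv; last by rewrite mul0r.
pose s := ((u + v) %/ 3)%Z; pose y := ((u - 2 * v) %/ 3)%Z; rewrite -/s -/y.
have -> : u = y + 2 * s by rewrite /s /y; lia.
have -> : v = s - y by rewrite /s /y; lia.
clearbody s y; rewrite !mul1r.
have [y2|y2] := boolP (2 %| y)%Z; first by rewrite !chi4_even ?mul0r ?mulr0 //; lia.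
have [s2|s2] := boolP (2 %| s)%Z.
  rewrite ifF; last by lia.
  by rewrite (@eq_chi4 (y + 2 * s) y) ?subr0 //; lia.
by rewrite ifT; [rewrite subrr !mul0r | lia].
Qed.

(** For [s] and [y] odd, u + y = 2 (y + s) is divisible by 4, so the rotation reverses the sign of
    the character. *)
Lemma theta2_rotO k :
  theta2 3 6 (fun y s => ndv 2 s * (chi4 y * (y + 2 * s) ^+ k)) = - rotO k.
Proof.
rewrite theta2_rot3 -theta2N; apply: eq_theta2 => u v; rewrite /ndv /dv.
case: ifP => uv; last by rewrite mul0r oppr0.
pose s := ((u + v) %/ 3)%Z; pose y := ((u - 2 * v) %/ 3)%Z; rewrite -/s -/y.
have -> : u = y + 2 * s by rewrite /s /y; lia.
have -> : v = s - y by rewrite /s /y; lia.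
clearbody s y; rewrite !mul1r.
have [y2|y2] := boolP (2 %| y)%Z; first by rewrite !chi4_even ?mul0r ?mulr0 ?oppr0 //; lia.
have [s2|s2] := boolP (2 %| s)%Z.
  by rewrite ifF; [rewrite subrr !mul0r oppr0 | lia].
rewrite ifT; last by lia.
by rewrite (@chi4_opp y (y + 2 * s)); [ring | lia].
Qed.

Lemma dv_opp d x : dv d (- x) = dv d x.
Proof. by rewrite /dv !dvdzE abszN. Qed.

Lemma theta2_linear a b (e p : int -> int) k : (0 < a)%N -> (0 < b)%N ->
  (forall y, e (- y) = e y) ->
  theta2 a b (fun x y => e y * (p x * (x + k * y) ^+ 1)) =
    theta1 a (fun x => x * p x) * theta1 b (fun y => e y * y ^+ 0).
Proof.
move=> a0 b0 ee; rewrite theta1M // -[RHS]addr0.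
rewrite -(@theta2_oddr0 a b (fun x y => e y * p x * (k * y))) => // [|x y].
  by rewrite -theta2D; apply: eq_theta2 => x y; ring.
by rewrite ee; ring.
Qed.

(** In (x + 2 y)^3 the terms 6 x^2 y and 8 y^3 are odd in [y] and sum to zero, leaving x^3 + 12 x
    y^2. *)
Lemma theta2_cubic a b (e p : int -> int) : (0 < a)%N -> (0 < b)%N ->
  (forall y, e (- y) = e y) ->
  theta2 a b (fun x y => e y * (p x * (x + 2 * y) ^+ 3)) =
    theta1 a (fun x => x ^+ 3 * p x) * theta1 b (fun y => e y * y ^+ 0)
    + (theta1 a (fun x => x * p x) * theta1 b (fun y => e y * y ^+ 2)) *+ 12.
Proof.
move=> a0 b0 ee; rewrite !theta1M // -[RHS]addr0.
rewrite -(@theta2_oddr0 a b (fun x y => e y * p x * (6 * x ^+ 2 * y + 8 * y ^+ 3)))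
  => // [|x y].
  by rewrite -theta2Z -!theta2D; apply: eq_theta2 => x y; ring.
by rewrite ee; ring.
Qed.

Lemma rotE1 : rotE 1 = jacobi2 * theta_even 0.
Proof. by rewrite -theta2_rotE theta2_linear // => y; rewrite dv_opp. Qed.

Lemma rotE3 : rotE 3 = jacobi2_cube * theta_even 0 + (jacobi2 * theta_even 2) *+ 12.
Proof. by rewrite -theta2_rotE theta2_cubic // => y; rewrite dv_opp. Qed.

Lemma rotO1 : - rotO 1 = jacobi2 * theta_odd 0.
Proof. by rewrite -theta2_rotO theta2_linear // => y; rewrite /ndv dv_opp. Qed.

Lemma rotO3 : - rotO 3 = jacobi2_cube * theta_odd 0 + (jacobi2 * theta_odd 2) *+ 12.
Proof. by rewrite -theta2_rotO theta2_cubic // => y; rewrite /ndv dv_opp. Qed.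

Lemma dv3_add_sub u v :
  dv 3 (u + v) + dv 3 (u - v) = ndv 3 u * ndv 3 v + 2 * (dv 3 u * dv 3 v).
Proof.
have res x : (x %% 3)%Z = 0 \/ (x %% 3)%Z = 1 \/ (x %% 3)%Z = 2 by lia.
have dvE x : dv 3 x = if (x %% 3)%Z == 0 then 1 else 0.
  by rewrite /dv; congr (if _ then _ else _); lia.
rewrite /ndv !dvE.
have -> : ((u + v) %% 3)%Z = (((u %% 3)%Z + (v %% 3)%Z) %% 3)%Z by lia.
have -> : ((u - v) %% 3)%Z = (((u %% 3)%Z + (3 - (v %% 3)%Z)) %% 3)%Z by lia.
by have [->|[->|->]] := res u; have [->|[->|->]] := res v.
Qed.

(** Averaging over the sign of [v] replaces the condition 3 | u + v, which couples the variables, by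
    separate conditions on [u] and [v], so the double sum factors. *)
Lemma theta2_dv3_split (e : int -> int) k : (forall y, e (- y) = e y) ->
  (theta2 1 2 (fun u v => dv 3 (u + v) * (e v * (chi4 u * u ^+ k)))) *+ 2 =
  theta_ndv3 k * th2 e (ndv 3) + (theta_dv3 k * th2 e (dv 3)) *+ 2.
Proof.
move=> ee; rewrite mulr2n {2}theta2_oppr //.
rewrite /theta_ndv3 /theta_dv3 /th2 !theta1M // -theta2Z -!theta2D.
apply: eq_theta2 => u v; rewrite ee -mulrDl dv3_add_sub; ring.
Qed.

Lemma rotE_split k :
  rotE k *+ 2 = theta_ndv3 k * th2 (ndv 2) (ndv 3) + (theta_dv3 k * th2 (ndv 2) (dv 3)) *+ 2.
Proof. by apply: theta2_dv3_split => y; rewrite /ndv dv_opp. Qed.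

Lemma rotO_split k :
  rotO k *+ 2 = theta_ndv3 k * th2 (dv 2) (ndv 3) + (theta_dv3 k * th2 (dv 2) (dv 3)) *+ 2.
Proof. by apply: theta2_dv3_split => y; rewrite dv_opp. Qed.

(** The determinant of [rotE], [rotO] at k = 1, 3 is computed twice. By [rotE1] to [rotO3] the terms
    in [jacobi2_cube] cancel and [jacobi2_sqr] appears; by the splittings it is a product of two
    determinants, one of which is [eta2_sqr]. *)
Lemma jacobi2_pow4 :
  jacobi2 ^+ 4 *+ 24 = eta2 * eta2 * (theta_ndv3 3 * theta_dv3 1 - theta_ndv3 1 * theta_dv3 3).
Proof.
have -> : jacobi2 ^+ 4 = (jacobi2 * jacobi2) * jacobi2 ^+ 2 by ring.
rewrite jacobi2_sqr eta2_sqr.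
transitivity ((- rotO 3 *+ 2) * (rotE 1 *+ 2) - (- rotO 1 *+ 2) * (rotE 3 *+ 2)).
  by rewrite rotE1 rotE3 rotO1 rotO3; ring.
by rewrite !mulNrn !rotE_split !rotO_split; ring.
Qed.

(** * The Jacobi series as the cube of eta *)

Lemma theta1_int a w n :
  theta1 a w n = (\sum_(x <- box n | a%:Z * x ^+ 2 == n) w x)%:~R.
Proof. by rewrite rmorph_sum. Qed.

(* The rotation of order 3 of the lattice of the form [x^2 + 3 y^2] fixes the
   polynomial, which is [- Im (x + y sqrt (-3))^3] up to a positive factor, and
   reverses the sign of the character. *)
Lemma theta2_rot_omega :
  theta2 1 3 (fun x y => chi12 x * chi4 y * (y ^+ 3 - x ^+ 2 * y)) = 0.
Proof.
set w := fun _ _ => _; apply: (@series_mulrn_eq0 _ 2) => //.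
suff e : theta2 1 3 w = theta2 1 3 (fun x y => - w x y).
  by rewrite mulr2n {1}e theta2N addNr.
(* Multiplication of x + y sqrt (-3) by one of the two primitive cube roots of unity, chosen so that
   both coordinates stay odd. The image falls in the other case, so [h] is an involution on the
   support. *)
pose h (p : int * int) : int * int := if (4 %| p.1 + p.2)%Z
  then (((- p.1 - 3 * p.2) %/ 2)%Z, ((p.1 - p.2) %/ 2)%Z)
  else (((3 * p.2 - p.1) %/ 2)%Z, ((- p.1 - p.2) %/ 2)%Z).
suff hP p : w p.1 p.2 != 0 ->
    [/\ 1%N%:Z * (h p).1 ^+ 2 + 3%N%:Z * (h p).2 ^+ 2 = 1%N%:Z * p.1 ^+ 2 + 3%N%:Z * p.2 ^+ 2,
        w (h p).1 (h p).2 = - w p.1 p.2 & h (h p) = p].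
  apply: (@theta2_reindex _ _ _ _ _ _ h h) => // p.
    by move=> /hP [-> -> ->]; rewrite opprK.
  by rewrite oppr_eq0 => /hP [-> -> ->].
case: p => x y; rewrite /w /chi12 [fst _]/= [snd _]/= !mulf_eq0 !negb_or.
case/andP => /andP[/andP[_ /chi4_neq0 x2] /chi4_neq0 y2] _.
have [xy|xy] := boolP (4 %| x + y)%Z.
  pose k := ((x + y) %/ 4)%Z; have xE : x = k *+ 4 - y by rewrite /k; lia.
  have hE : h (x, y) = (- k *+ 2 - y, k *+ 2 - y) by rewrite /h /= xy; congr pair; lia.
  rewrite hE [fst _]/= [snd _]/=.
  rewrite (@eq_chi3 (- k *+ 2 - y) x); last by lia.
  rewrite (@eq_chi4 (k *+ 2 - y) (- k *+ 2 - y)); last by lia.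
  rewrite (@chi4_opp y x); last by lia.
  rewrite -!mulrA ![chi4 _ * (chi4 _ * _)]mulrA mulNr mulrA (mulrA (chi4 _)).
  rewrite !chi4_sqr //; last by lia.
  split; [rewrite xE; ring | rewrite xE; ring | ].
  by rewrite /h /= ifF; [congr pair; lia | lia].
pose k := ((x - y) %/ 4)%Z; have xE : x = k *+ 4 + y by rewrite /k; lia.
have hE : h (x, y) = (y - k *+ 2, - k *+ 2 - y).
  by rewrite /h /= ifF; [congr pair; lia | lia].
rewrite hE [fst _]/= [snd _]/=.
rewrite (@eq_chi3 (y - k *+ 2) x); last by lia.
rewrite (@chi4_opp (y - k *+ 2) (- k *+ 2 - y)); last by lia.
rewrite (@eq_chi4 x y); last by lia.
rewrite -!mulrA mulNr mulrN ![chi4 _ * (chi4 _ * _)]mulrA !chi4_sqr //; last by lia.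
split; [rewrite xE; ring | rewrite xE; ring | ].
by rewrite /h /= ifT; [congr pair; lia | lia].
Qed.

(** The difference of the two sides is three times the theta series that vanishes by
    [theta2_rot_omega]. *)
Lemma eta2_jacobi2_ode : eta2 * qderiv jacobi2 = (qderiv eta2 *+ 3) * jacobi2.
Proof.
apply/eqP; rewrite -subr_eq0 mulrnAl /eta2 /jacobi2 !qderiv_theta1 !theta1M // -theta2Z -theta2B.
apply/eqP; rewrite -[RHS](mul0rn _ 3) -theta2_rot_omega -theta2Z.
by apply: eq_theta2 => x y; ring.
Qed.

Lemma eta2_low : sorder 1 eta2 /\ eta2 1%N = 2.
Proof.
split; last by rewrite /eta2 theta1_int unlock.
by case=> // _; rewrite /eta2 theta1_int unlock.
Qed.

Lemma jacobi2_eta2 : jacobi2 *+ 4 = eta2 ^+ 3.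
Proof.
have [Hlow H1] := eta2_low.
have H2low : sorder 2 (eta2 ^+ 2) by rewrite expr2; apply: (sorderM Hlow Hlow).
have H3_3 : (eta2 ^+ 3) 3%N = 8.
  rewrite exprS (@scoefM_low 1 2) // expr2 (@scoefM_low 1 1) // H1; ring.
have K_3 : jacobi2 3%N = 2 by rewrite /jacobi2 theta1_int unlock.
apply/eqP; rewrite -subr_eq0; apply/eqP.
apply: (@qderiv_uniq 1 eta2 (qderiv eta2 *+ 3)) => //.
- by move=> [] // _; rewrite scoefMn /qderiv mul0r mul0rn.
- have -> : qderiv (jacobi2 *+ 4 - eta2 ^+ 3) = qderiv jacobi2 *+ 4 - qderiv (eta2 ^+ 3).
    by apply/funext => n; rewrite scoefB scoefMn /qderiv scoefB scoefMn; ring.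
  rewrite qderivX mulrBr mulrnAr eta2_jacobi2_ode; ring.
(* The only indicial root is 3, where both series have coefficient 4 * 2 = 2^3. *)
move=> n; rewrite scoefMn /qderiv H1 => /eqP.
have -> : n%:R * 2 - (1 * 2) *+ 3 = (n%:R - 3%:R) * 2 :> rat by ring.
rewrite mulf_eq0 orbF subr_eq0 eqr_nat => /eqP ->.
by rewrite scoefB scoefMn K_3 H3_3; apply/eqP.
Qed.

(** * The tenth power of eta and its coefficients divisible by 7 *)

Definition winquist : series := theta_ndv3 3 * theta_dv3 1 - theta_ndv3 1 * theta_dv3 3.

Lemma eta2_pow10 : eta2 ^+ 10 *+ 3 = winquist *+ 32.
Proof.
have [Hlow H1] := eta2_low.
(* Here 256 = 4^4 comes from substituting [jacobi2_eta2] into [jacobi2_pow4]; the two factors [eta2]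
   are then cancelled. *)
have : eta2 * (eta2 * (eta2 ^+ 10 *+ 24 - winquist *+ 256)) = 0.
  have -> : eta2 * (eta2 * (eta2 ^+ 10 *+ 24 - winquist *+ 256)) =
      (eta2 ^+ 3) ^+ 4 *+ 24 - (eta2 * eta2 * winquist) *+ 256.
    by ring.
  rewrite -jacobi2_eta2 -jacobi2_pow4; ring.
have H1nz : eta2 1%N != 0 by rewrite H1.
move/(smul_eq0_low Hlow H1nz)/(smul_eq0_low Hlow H1nz).
have -> : eta2 ^+ 10 *+ 24 - winquist *+ 256 = (eta2 ^+ 10 *+ 3 - winquist *+ 32) *+ 8 by ring.
by move/(@series_mulrn_eq0 _ 8 isT)/eqP; rewrite subr_eq0 => /eqP.
Qed.

(** -1 is not a square modulo 7; the residues are checked exhaustively. *)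
Lemma dvd7_sum_sqr (x y : int) : (7 %| x ^+ 2 + y ^+ 2)%Z -> (7 %| x)%Z /\ (7 %| y)%Z.
Proof.
pose q z := (z %/ 7)%Z; pose r z := (z %% 7)%Z.
have rP z : r z \in [:: 0; 1; 2; 3; 4; 5; 6] by rewrite /r !inE; lia.
have zE z : z = 7 * q z + r z by rewrite /q /r; lia.
have check : all (fun a : int => all (fun b : int =>
    (((a ^+ 2 + b ^+ 2) %% 7)%Z == 0) ==> (a == 0) && (b == 0))
  [:: 0; 1; 2; 3; 4; 5; 6]) [:: 0; 1; 2; 3; 4; 5; 6] by vm_compute.
have -> : x ^+ 2 + y ^+ 2 = (7 * q x ^+ 2 + 2 * q x * r x + 7 * q y ^+ 2 + 2 * q y * r y) * 7
    + (r x ^+ 2 + r y ^+ 2) by rewrite {1}(zE x) {1}(zE y); ring.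
move/dvdz_mod0P; rewrite modzMDl => /eqP xy.
by have /allP/(_ _ (rP y))/implyP/(_ xy)/andP[] := allP check _ (rP x); rewrite /r; lia.
Qed.

Lemma winquist_coef n : exists c : int, winquist (7 * n)%N = (49 * c)%:~R.
Proof.
rewrite /winquist /theta_ndv3 /theta_dv3 !theta1M // -theta2B /theta2.
elim/big_ind: _ => [|_ _ [c ->] [c' ->]|[x y] /= /eqP xyn].
- by exists 0; rewrite mulr0.
- by exists (c + c'); rewrite mulrDr rmorphD.
have [x7 y7] : (7 %| x)%Z /\ (7 %| y)%Z by apply: dvd7_sum_sqr; lia.
have xy : x * y = 49 * ((x %/ 7)%Z * (y %/ 7)%Z).
  by rewrite -{1}(divzK x7) -{1}(divzK y7); ring.
exists (ndv 3 x * chi4 x * (dv 3 y * chi4 y) * (x ^+ 2 - y ^+ 2) * ((x %/ 7)%Z * (y %/ 7)%Z)).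
congr (_%:~R).
transitivity (ndv 3 x * chi4 x * (dv 3 y * chi4 y) * (x ^+ 2 - y ^+ 2) * (x * y)); first ring.
by rewrite xy; ring.
Qed.

(** * The pentagonal number theorem *)

(** The quotient (x; x)_n / (x; x)_k for k <= n, written without division. *)
Definition qfact_ratio (R : comNzRingType) (x : R) (n k : nat) : R :=
  \prod_(k <= i < n) (1 - x ^+ i.+1).

Lemma shanks_telescope (R : comNzRingType) (x : R) n m : (m <= n)%N ->
  \sum_(k < m.+1) (-1) ^+ k * qfact_ratio x n k * x ^+ (n * k + 'C(k.+1, 2)) *
    (x ^+ k * (1 - x ^+ n.+1) - 1) =
  (-1) ^+ m.+1 * qfact_ratio x n m * x ^+ (n * m.+1 + 'C(m.+2, 2)).
Proof.
elim: m => [|m IH] le_mn.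
  by rewrite big_ord1 muln0 muln1 binn addn1 /= expr0 expr1; ring.
rewrite big_ord_recr IH ?(ltnW le_mn) //=.
rewrite [qfact_ratio x n m]/qfact_ratio big_ltn // -/(qfact_ratio x n m.+1).
have -> : (n * m.+2 + 'C(m.+3, 2) = n * m.+1 + 'C(m.+2, 2) + m.+1 + n.+1)%N.
  by rewrite [in LHS]binS bin1; lia.
by rewrite (exprD x (_ + m.+1)) (exprD x (_ + 'C(_, _))) !(exprS (-1)); ring.
Qed.

(* Shanks: truncating the theta series at [|k| <= n] only perturbs the finite
   Euler product by the terms [k >= 1] of the right-hand side, of order [> n]. *)
Lemma shanks (R : comNzRingType) (x : R) n :
  1 + \sum_(j < n) (-1) ^+ j.+1 *
    (x ^+ (j.+1 * j.+1 + 'C(j.+2, 2)) + x ^+ (j * j.+1 + 'C(j.+2, 2))) =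
  \sum_(k < n.+1) (-1) ^+ k * qfact_ratio x n k * x ^+ (n * k + 'C(k.+1, 2)).
Proof.
elim: n => [|n IH].
  by rewrite big_ord0 big_ord1 /qfact_ratio big_geq // muln0 /= !expr0; ring.
rewrite big_ord_recr addrA IH [RHS]big_ord_recr /= [qfact_ratio x n.+1 n.+1]/qfact_ratio big_geq //.
(* Passing from [n] to [n.+1] multiplies the [k]-th term by x^k (1 - x^(n+1)). The resulting change
   telescopes to one of the two new pentagonal terms; the other is the new term k = n + 1. *)
have -> : \sum_(k < n.+1) (-1) ^+ k * qfact_ratio x n.+1 k * x ^+ (n.+1 * k + 'C(k.+1, 2)) =
    \sum_(k < n.+1) (-1) ^+ k * qfact_ratio x n k * x ^+ (n * k + 'C(k.+1, 2)) +
    \sum_(k < n.+1) (-1) ^+ k * qfact_ratio x n k * x ^+ (n * k + 'C(k.+1, 2)) *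
      (x ^+ k * (1 - x ^+ n.+1) - 1).
  rewrite -big_split; apply: eq_bigr => k _ /=.
  have le_kn : (k <= n)%N by rewrite -ltnS.
  rewrite [qfact_ratio x n.+1 k]/qfact_ratio big_nat_recr //= -/(qfact_ratio x n k).
  rewrite mulSn -addnA (exprD x k).
  by set y := x ^+ (_ + _); ring.
rewrite shanks_telescope // [qfact_ratio x n n]/qfact_ratio big_geq //; ring.
Qed.

(** With m = j + 1, the exponents are the pentagonal numbers m (3 m + 1) / 2 and m (3 m - 1) / 2. *)
Definition pent (n : nat) : series := 1 + \sum_(j < n) (-1) ^+ j.+1 *
  (monom (j.+1 * j.+1 + 'C(j.+2, 2)) + monom (j * j.+1 + 'C(j.+2, 2))).

Lemma pent_euler n i : (i <= n)%N -> pent n i = euler i.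
Proof.
move=> le_in.
have -> : pent n = \sum_(k < n.+1) (-1) ^+ k * qfact_ratio (monom 1) n k
    * monom 1 ^+ (n * k + 'C(k.+1, 2)).
  rewrite -shanks; congr (1 + _); apply: eq_bigr => j _.
  by rewrite !monomX !mul1n.
rewrite big_ord_recl scoefD muln0 /= expr0 mul1r mulr1 scoef_sum [X in _ + X]big1 ?addr0.
  rewrite /qfact_ratio big_mkord -(eulerE le_in); congr (_ i).
  by apply: eq_bigr => j _; rewrite monomX mul1n.
move=> k _; rewrite monomX mul1n mulrC scoef_monomM leqNgt.
by rewrite (_ : (i < _)%N) //= /bump leq0n add1n mulnS binS bin1; lia.
Qed.

(** * Dilation of series *)

Definition dilate (k : nat) (f : series) : series :=
  fun n => if (k %| n)%N then f (n %/ k)%N else 0.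

Fact dilate_is_zmod_morphism k : zmod_morphism (dilate k).
Proof.
by move=> f g; apply/funext => n; rewrite scoefB /dilate; case: ifP; rewrite ?scoefB ?subrr.
Qed.
HB.instance Definition _ k := GRing.isZmodMorphism.Build series series (dilate k)
  (dilate_is_zmod_morphism k).

Fact dilate_is_monoid_morphism k : monoid_morphism (dilate k.+1).
Proof.
split=> [|f g]; apply/funext => n.
  rewrite /dilate !scoef1; case: ifP => [/dvdnP[q ->]|].
    by rewrite mulnK // muln_eq0 orbF.
  by case: eqP => // ->; rewrite dvdn0.
(* Up to degree [n], dilation is composition of the truncated polynomial with a power of the
   variable, which is multiplicative. *)
have dil (h : series) i : (i <= n)%N ->
    dilate k.+1 h i = (strunc n h \Po 'X^(k.+1))`_i.
  move=> le_in; rewrite coef_comp_poly_Xn // /dilate; case: ifP => // _.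
  by rewrite coef_strunc // (leq_trans (leq_div _ _)).
transitivity (((strunc n f * strunc n g) \Po 'X^(k.+1))`_n).
  rewrite coef_comp_poly_Xn // /dilate; case: ifP => // _.
  by rewrite -smul_strunc ?leq_div.
rewrite comp_polyM coefM scoefM; apply: eq_bigr => i _.
by rewrite !dil ?leq_subr // -ltnS.
Qed.
HB.instance Definition _ k := GRing.isMonoidMorphism.Build series series (dilate k.+1)
  (dilate_is_monoid_morphism k).

Lemma dilate_monom k m : (0 < k)%N -> dilate k (monom m) = monom (k * m).
Proof.
move=> k0; apply/funext => n; rewrite /dilate /monom.
case: ifP => [/dvdnP[q ->]|]; first by rewrite mulnK // mulnC eqn_pmul2l.
by case: eqP => // ->; rewrite dvdn_mulr.
Qed.

(** * The pentagonal series as a theta series *)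

Lemma chi12_6n n : chi12 (6 * n + 5)%N = (-1) ^+ n.+1 /\ chi12 (6 * n + 7)%N = (-1) ^+ n.+1.
Proof.
have chi4_odd m : chi4 (2 * m + 1)%N = (-1) ^+ m.
  elim: m => // m IH; rewrite exprS mulN1r -IH; apply: chi4_opp; lia.
rewrite /chi12; split.
  rewrite (@eq_chi3 _ (-1)) 1?(@eq_chi4 _ (2 * n + 1)%N); try lia.
  by rewrite chi4_odd exprS.
rewrite (@eq_chi3 _ 1) 1?(@eq_chi4 _ (2 * n.+1 + 1)%N); try lia.
by rewrite chi4_odd mul1r.
Qed.

Lemma chi12_opp x : chi12 (- x) = chi12 x.
Proof.
have chi3N : chi3 (- x) = - chi3 x.
  rewrite /chi3; have [e|[e|e]] : (x %% 3)%Z = 0 \/ (x %% 3)%Z = 1 \/ (x %% 3)%Z = 2 by lia.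
  - by rewrite e (_ : ((- x) %% 3)%Z = 0) //; lia.
  - by rewrite e (_ : ((- x) %% 3)%Z = 2) //; lia.
  - by rewrite e (_ : ((- x) %% 3)%Z = 1) //; lia.
by rewrite /chi12 chi3N (@chi4_opp x (- x)) ?mulrNN // subrr dvdz0.
Qed.

Lemma chi12_eq0 x : (2 %| x)%Z || (3 %| x)%Z -> chi12 x = 0.
Proof.
rewrite /chi12 => /orP[/chi4_even -> | x3]; first by rewrite mulr0.
by rewrite /chi3 (_ : (x %% 3)%Z = 0) ?mul0r //; lia.
Qed.

(** Since 1 + 24 m (3 m ± 1) / 2 = (6 m ± 1)^2, the pentagonal exponents become squares. The bound 6
    n + 4 lies between 6 n + 1 and 6 n + 5, so each induction step adds just 6 n + 5, 6 n + 7 and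
    their opposites as integers prime to 6. *)
Lemma box_pent n N :
  \sum_(x <- box (6 * n + 4) | x ^+ 2 == N%:Z) (chi12 x)%:~R =
  ((monom 1 * dilate 24 (pent n)) *+ 2) N.
Proof.
pose F (x : int) : rat := if x ^+ 2 == N%:Z then (chi12 x)%:~R else 0.
have FN x : F (- x) = F x by rewrite /F sqrrN chi12_opp.
have F0 x : (2 %| x)%Z || (3 %| x)%Z -> F x = 0.
  by move=> /chi12_eq0 x0; rewrite /F x0; case: ifP.
have boxS m : \sum_(x <- box m.+1) F x = F m.+1 *+ 2 + \sum_(x <- box m) F x.
  by rewrite /= !big_cons FN addrA.
rewrite big_mkcond -/(F _) /=; under eq_bigr do rewrite -/(F _).
elim: n => [|n IH].
  rewrite /pent big_ord0 addr0 rmorph1 mulr1 muln0 add0n !boxS /= big_seq1.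
  rewrite [F 4]F0 // [F 3]F0 // [F 2]F0 // [F 0]F0 // !mul0rn !add0r addr0 scoefMn.
  rewrite /F /monom (_ : (1 ^+ 2 == N%:Z) = (N == 1%N)); first by case: eqP.
  by apply/eqP/eqP; lia.
have -> : (6 * n.+1 + 4 = (6 * n + 4).+1.+1.+1.+1.+1.+1)%N by lia.
rewrite !boxS IH.
rewrite [F (_ + 4).+2]F0; last by lia.
rewrite [F (_ + 4).+4]F0; last by lia.
rewrite [F (_ + 4).+4.+1]F0; last by lia.
rewrite [F (_ + 4).+4.+2]F0; last by lia.
have -> : pent n.+1 = pent n + (-1) ^+ n.+1 *
    (monom (n.+1 * n.+1 + 'C(n.+2, 2)) + monom (n * n.+1 + 'C(n.+2, 2))).
  by rewrite /pent big_ord_recr addrA.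
move: (pent n) => P.
rewrite rmorphD mulrDr mulrnDl scoefD [RHS]addrC !mul0rn !add0r addrA; congr (_ + _).
rewrite rmorphM rmorphD rmorphXn rmorphN1 /= !dilate_monom // mulrCA mulrDr -!monomD.
have tri : ('C(n.+2, 2) * 2 = n.+2 * n.+1)%N by rewrite mulnC -(mul_bin_diag n.+2 1) bin1.
have -> : (1 + 24 * (n.+1 * n.+1 + 'C(n.+2, 2)) = (6 * n + 7) ^ 2)%N by lia.
have -> : (1 + 24 * (n * n.+1 + 'C(n.+2, 2)) = (6 * n + 5) ^ 2)%N by lia.
have [c5 c7] := chi12_6n n.
have sgnE (f : series) : ((-1) ^+ n.+1 * f) N = (-1) ^+ n.+1 * f N.
  by rewrite -signr_odd -[in RHS]signr_odd; case: odd; rewrite ?expr0 ?expr1 ?mul1r // !mulN1r.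
rewrite scoefMn sgnE scoefD mulrDr mulrnDl.
have FE (m : nat) : chi12 m = (-1) ^+ n.+1 -> F m = (-1) ^+ n.+1 * monom (m ^ 2) N.
  move=> cm; rewrite /F cm /monom (_ : (m%:Z ^+ 2 == N) = (N == m ^ 2)%N).
    by case: eqP => _; rewrite ?mulr1 ?mulr0 // rmorphXn rmorphN1.
  by rewrite expr2 -mulnn; apply/eqP/eqP; lia.
rewrite -(FE _ c5) -(FE _ c7).
by congr (F _ *+ 2 + F _ *+ 2); lia.
Qed.

Lemma eta2_euler : eta2 = (monom 1 * dilate 24 euler) *+ 2.
Proof.
apply/funext => N.
have -> : eta2 N = \sum_(x <- box (6 * N + 4) | x ^+ 2 == N%:Z) (chi12 x)%:~R.
  rewrite /eta2 (@theta1_box _ _ (6 * N + 4)) //; last by lia.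
  by apply: eq_bigl => x; rewrite mul1r.
rewrite box_pent !scoefMn !scoef_monomM; case: ifP => // _; congr (_ *+ 2).
by rewrite /dilate; case: ifP => // _; rewrite pent_euler //; lia.
Qed.

(** * The congruence *)

Lemma euler10_coef n : pdvd 7 49 ((euler ^+ 10) (7 * n + 6)%N).
Proof.
have HE : (eta2 ^+ 10) (24 * (7 * n + 6) + 10)%N = (euler ^+ 10) (7 * n + 6)%N *+ 1024.
  have -> : eta2 ^+ 10 = (monom 10 * dilate 24 (euler ^+ 10)) *+ 1024.
    rewrite rmorphXn /= eta2_euler (_ : monom 10 = monom 1 ^+ 10); last by rewrite monomX.
    by move: (monom 1) (dilate 24 euler) => u v; ring.
  by rewrite scoefMn scoef_monomM leq_addl addnK /dilate dvdn_mulr // mulKn.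
(* The factor q^10 of eta^10 moves the index to 24 (7 n + 6) + 10 = 7 (24 n + 22), a multiple of
   7. *)
have [c cE] := winquist_coef (24 * n + 22).
apply: (@pdvd_cancel 7 49 96) => //.
have -> : 96%:R * (euler ^+ 10) (7 * n + 6)%N = winquist (7 * (24 * n + 22))%N.
  have := congr1 (fun f : series => f (24 * (7 * n + 6) + 10)%N) eta2_pow10.
  rewrite !scoefMn HE (_ : (24 * (7 * n + 6) + 10 = 7 * (24 * n + 22))%N); last by lia.
  set e := _ (7 * n + 6)%N; set w := winquist _ => ew.
  have : (96%:R * e - w) * 32%:R = 0 by rewrite -[RHS](subrr (w *+ 32)) -{1}ew; ring.
  by move/eqP; rewrite mulf_eq0 orbF subr_eq0 => /eqP.
by rewrite cE; have := pdvd_int 7 49 c; rewrite rmorphM.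
Qed.

Lemma sint_euler p : sint p euler.
Proof.
have mon m : sint p (monom m).
  by move=> n; have := pdvd_int p 1 (n == m); rewrite mul1r -pmulrn.
suff prod_int N : sint p (\prod_(i < N) (1 - monom i.+1)) by move=> n; apply: prod_int.
elim: N => [|N IH]; first by rewrite big_ord0 -monom0.
rewrite big_ord_recr; apply: (sintM IH) => i.
by rewrite -monom0; apply: pdvdD (mon _ _) (pdvdN (mon _ _)).
Qed.

Theorem mainTheorem3 (n : nat) :
  rat_eq0_mod 49 (pfrac (1%:Q / 5%:Q)%R (7 * n + 6)).
Proof.
have -> : 1%:Q / 5%:Q = 5%:R^-1 by rewrite mul1r.
set f : series := pfrac _; have f5 : f ^+ 5 = euler by apply: pfrac_rootX.
have f0 : f 0%N = 1 by [].
have fint : sint 7 f by apply: (@sint_root 7 5) => //; rewrite f5; apply: sint_euler.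
apply: (@pdvd_rat_eq0_mod 7 1) => //.
apply: (@pdvd_scoef_progression 7 49 f 6) => // [m m6|]; last by rewrite mulnC modnMDl.
(* The exponent 49 + 1 is a multiple of 5, so an integral power of the Euler product appears. *)
have -> : f ^+ 50 = euler ^+ 10 by rewrite -f5 -exprM.
by rewrite (divn_eq m 7) m6 mulnC; apply: euler10_coef.
Qed.
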